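(* Let $n\ge1$. The algebra $W(n,1)$ is a deformation of $A_n^!$ in the following precise sense: $\Bbbk[x_1,\dots,x_n]$ is a subalgebra of $W(n,1)$ (via $x_l\mapsto\sum_{i>l}y_le_i+\sum_{i\le l}y_{l+1}e_i$), and if $\mathfrak m\subset\Bbbk[x_1,\dots,x_n]$ is the ideal of polynomials with zero constant term, then the quotient of $W(n,1)$ by the two-sided ideal generated by $\mathfrak m$ is isomorphic, as an algebra, to $A_n^!$: $$W(n,1)/\mathfrak m\cong A_n^! .$$
   Context: $\Bbbk$ is an infinite field of characteristic not equal to $2$. **The algebra $W(n,1)$.** It is the graded unital associative $\Bbbk$-algebra with generators $e_1,\dots,e_{n+1}$, $y_1,\dots,y_{n+1}$, $\psi_1,\dots,\psi_n$ of degrees $\deg e_i=0$, $\deg y_j=2$, $\deg\psi_j=1$, and relations: $e_ie_j=\delta_{ij}e_i$, $\sum_i e_i=1$; $y_je_i=e_iy_j$; $y_jy_l=y_ly_j$; $\psi_je_i=0$ if $i\notin\{j,j+1\}$; $\psi_je_j=e_{j+1}\psi_j$ and $\psi_je_{j+1}=e_j\psi_j$; $\psi_j\psi_l=\psi_l\psi_j$ if $|j-l|>1$; $\psi_jy_l=y_l\psi_j$ if $l\ne j,j+1$; $\psi_jy_j=y_{j+1}\psi_j$; $y_j\psi_j=\psi_jy_{j+1}$; $\psi_j^2e_j=(y_j-y_{j+1})e_j$; $\psi_j^2e_{j+1}=(y_{j+1}-y_j)e_{j+1}$; $\psi_j\psi_{j+1}\psi_j=\psi_{j+1}\psi_j\psi_{j+1}$;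 $e_1=0$. **The algebra $A_n^!$.** Let $Q$ be the quiver with vertices $1,\dots,n$ and, for each $1\le i\le n-1$, one arrow $i\to i+1$ and one arrow $i+1\to i$. Let $\Bbbk Q$ be its path algebra (product given by concatenation); a path is written $(i_r|\cdots|i_1)$ with starting point $i_1$ and ending point $i_r$, and $(i)$ is the length-zero path at $i$. Then $A_n^!$ is the quotient of $\Bbbk Q$ by the two-sided ideal generated by $(i|i-1|i)-(i|i+1|i)$ for $i=1,\dots,n-1$, where by convention $(1|0|1)=0$. *)

(* Defs.v *)
From HB Require Import structures.
From mathcomp Require Import all_boot all_order all_algebra.
From mathcomp Require boolp classical_sets cardinality.
From mathcomp Require Import finmap.

Set Implicit Arguments.
Unset Strict Implicit.
Unset Printing Implicit Defensive.

Import GRing.Theory.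
Local Open Scope ring_scope.
Local Open Scope quotient_scope.

(* A unital associative K-algebra, presented as a ring with a ring morphism   *)
(* from K to its center: c *: x is kalgC c * x. Unlike for algType, 1 = 0 is  *)
(* allowed, as a quotient by an arbitrary two-sided ideal may vanish.         *)
HB.mixin Record isKAlgebra (K : comPzRingType) A of GRing.PzRing A := {
  kalgC : K -> A;
  kalgC_zmod : zmod_morphism kalgC;
  kalgC_monoid : monoid_morphism kalgC;
  kalgC_comm : forall (c : K) (x : A), kalgC c * x = x * kalgC c
}.

#[short(type="kalgType")]
HB.structure Definition KAlgebra (K : comPzRingType) :=
  {A of isKAlgebra K A & GRing.PzRing A}.

(* c = 1 in the last clause gives f 1 = 1. *)
Definition kalg_morphism (K : comPzRingType) (A B : kalgType K) (f : A -> B) :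
    Prop :=
  [/\ {morph f : x y / x + y}, {morph f : x y / x * y}
    & forall c : K, f (kalgC c) = kalgC c].

Definition kalg_isomorphic (K : comPzRingType) (A B : kalgType K) : Prop :=
  exists f : A -> B, kalg_morphism f /\ bijective f.

Lemma bilinear_mulA (k : comNzRingType) (L : lmodType k) (T : Type) (g : T -> L)
    (mul : L -> L -> L) :
    (forall P : L -> Prop, P 0 -> (forall x y, P x -> P y -> P (x + y)) ->
       (forall a t, P (a *: g t)) -> forall x, P x) ->
    left_distributive mul +%R -> right_distributive mul +%R ->
    (forall a x y, mul (a *: x) y = a *: mul x y) ->
    (forall a x y, mul x (a *: y) = a *: mul x y) ->
    (forall p q r, mul (g p) (mul (g q) (g r)) = mul (mul (g p) (g q)) (g r)) ->
  associative mul.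
Proof.
move=> ind Dl Dr Zl Zr gA.
have m0l x : mul 0 x = 0 by rewrite -[in LHS](scale0r 0) Zl scale0r.
have m0r x : mul x 0 = 0 by rewrite -[in LHS](scale0r 0) Zr scale0r.
apply: (ind _) => [|x1 x2 IH1 IH2|a p]; first by move=> y z; rewrite !m0l.
  by move=> y z; rewrite !Dl IH1 IH2.
apply: (ind _) => [|y1 y2 IH1 IH2|b q]; first by move=> z; rewrite m0l !m0r m0l.
  by move=> z; rewrite !(Dl, Dr) IH1 IH2.
apply: (ind _) => [|z1 z2 IH1 IH2|c r]; first by rewrite !m0r.
  by rewrite !Dr IH1 IH2.
by rewrite !(Zl, Zr) gA !scalerA -(mulrA c) (mulrC c).
Qed.

(* Paths in the quiver with vertex set V and one arrow u -> v whenever        *)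
(* arrow u v. There are no parallel arrows, so a path is determined by its    *)
(* vertices: (i_r|...|i_1) is the pair (i_r, [:: i_(r-1); ...; i_1]), listing *)
(* the vertices from the end to the start of the path.                        *)
Section Paths.
Variables (V : finType) (arrow : rel V).

Record qpath := QPath {
  qpath_val : V * seq V;
  qpathP : path (fun v u => arrow u v) qpath_val.1 qpath_val.2
}.
HB.instance Definition _ := [isSub for qpath_val].
HB.instance Definition _ := [Choice of qpath by <:].

Definition qpath_end (p : qpath) : V := (val p).1.
Definition qpath_start (p : qpath) : V := last (val p).1 (val p).2.

End Paths.

Section Quotient.
Variables (K : comPzRingType) (A : kalgType K) (S : A -> Prop).

Inductive ideal_gen : A -> Prop :=
| ideal_gen_in x of S x : ideal_gen x
| ideal_gen0 : ideal_gen 0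
| ideal_genD x y of ideal_gen x & ideal_gen y : ideal_gen (x + y)
| ideal_genMl a x of ideal_gen x : ideal_gen (a * x)
| ideal_genMr x a of ideal_gen x : ideal_gen (x * a).

Definition ideal_equiv (x y : A) : bool := boolp.asbool (ideal_gen (x - y)).

Lemma ideal_equivP x y : reflect (ideal_gen (x - y)) (ideal_equiv x y).
Proof. exact: boolp.asboolP. Qed.

Lemma ideal_genN x : ideal_gen x -> ideal_gen (- x).
Proof. by rewrite -mulN1r; apply: ideal_genMl. Qed.

Lemma ideal_equiv_refl : reflexive ideal_equiv.
Proof. by move=> x; apply/ideal_equivP; rewrite subrr; apply: ideal_gen0. Qed.

Lemma ideal_equiv_sym : symmetric ideal_equiv.
Proof.
by move=> x y; apply/ideal_equivP/ideal_equivP=> /ideal_genN; rewrite opprB.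
Qed.

Lemma ideal_equiv_trans : transitive ideal_equiv.
Proof.
move=> y x z /ideal_equivP xy /ideal_equivP yz; apply/ideal_equivP.
by have := ideal_genD xy yz; rewrite addrA subrK.
Qed.

Canonical ideal_equiv_equiv :=
  EquivRel ideal_equiv ideal_equiv_refl ideal_equiv_sym ideal_equiv_trans.
Canonical ideal_equiv_encModRel := defaultEncModRel ideal_equiv.

(* A modulo the two-sided ideal generated by S *)
Definition quotAlg : Type := {eq_quot ideal_equiv}.
HB.instance Definition _ := Choice.on quotAlg.
HB.instance Definition _ := EqQuotient.on quotAlg.

Definition quot_pi (x : A) : quotAlg := \pi_quotAlg x.

Lemma quot_piP x y : quot_pi x = quot_pi y <-> ideal_gen (x - y).
Proof. by split=> [/eqmodP/ideal_equivP|/ideal_equivP/eqmodP]. Qed.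

Lemma quot_reprK (x : quotAlg) : quot_pi (repr x) = x.
Proof. exact: reprK. Qed.

Lemma ideal_repr x : ideal_gen (repr (quot_pi x) - x).
Proof. by apply/quot_piP; rewrite quot_reprK. Qed.

Definition quot_zero : quotAlg := quot_pi 0.
Definition quot_one : quotAlg := quot_pi 1.
Definition quot_opp (x : quotAlg) := quot_pi (- repr x).
Definition quot_add (x y : quotAlg) := quot_pi (repr x + repr y).
Definition quot_mul (x y : quotAlg) := quot_pi (repr x * repr y).

Lemma quot_oppE x : quot_opp (quot_pi x) = quot_pi (- x).
Proof. by apply/quot_piP; rewrite -opprD; apply/ideal_genN/ideal_repr. Qed.

Lemma quot_addE x y : quot_add (quot_pi x) (quot_pi y) = quot_pi (x + y).
Proof.
by apply/quot_piP; rewrite opprD addrACA; apply: ideal_genD; apply: ideal_repr.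
Qed.

Lemma quot_mulE x y : quot_mul (quot_pi x) (quot_pi y) = quot_pi (x * y).
Proof.
apply/quot_piP; set x' := repr _; set y' := repr _.
rewrite -[x' * y'](subrK (x * y')) -addrA -mulrBl -mulrBr.
apply: ideal_genD; [apply: ideal_genMr | apply: ideal_genMl];
  exact: ideal_repr.
Qed.

Let qE := (quot_oppE, quot_addE, quot_mulE).

Lemma quot_addA : associative quot_add.
Proof.
by move=> x y z; rewrite -[x]quot_reprK -[y]quot_reprK -[z]quot_reprK !qE addrA.
Qed.

Lemma quot_addC : commutative quot_add.
Proof. by move=> x y; rewrite -[x]quot_reprK -[y]quot_reprK !qE addrC. Qed.

Lemma quot_add0 : left_id quot_zero quot_add.
Proof. by move=> x; rewrite -[x]quot_reprK !qE add0r. Qed.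

Lemma quot_addN : left_inverse quot_zero quot_opp quot_add.
Proof. by move=> x; rewrite -[x]quot_reprK !qE addNr. Qed.

HB.instance Definition _ :=
  GRing.isZmodule.Build quotAlg quot_addA quot_addC quot_add0 quot_addN.

Lemma quot_mulA : associative quot_mul.
Proof.
by move=> x y z; rewrite -[x]quot_reprK -[y]quot_reprK -[z]quot_reprK !qE mulrA.
Qed.

Lemma quot_mul1l : left_id quot_one quot_mul.
Proof. by move=> x; rewrite -[x]quot_reprK !qE mul1r. Qed.

Lemma quot_mul1r : right_id quot_one quot_mul.
Proof. by move=> x; rewrite -[x]quot_reprK !qE mulr1. Qed.

Lemma quot_mulDl : left_distributive quot_mul +%R.
Proof.
move=> x y z; rewrite -[x]quot_reprK -[y]quot_reprK -[z]quot_reprK.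
by rewrite /GRing.add /= !qE mulrDl.
Qed.

Lemma quot_mulDr : right_distributive quot_mul +%R.
Proof.
move=> x y z; rewrite -[x]quot_reprK -[y]quot_reprK -[z]quot_reprK.
by rewrite /GRing.add /= !qE mulrDr.
Qed.

HB.instance Definition _ := GRing.Zmodule_isPzRing.Build quotAlg
  quot_mulA quot_mul1l quot_mul1r quot_mulDl quot_mulDr.

Lemma quot_pi_zmod_morphism : zmod_morphism quot_pi.
Proof.
by move=> x y; rewrite -quot_addE -quot_oppE.
Qed.

Lemma quot_pi_monoid_morphism : monoid_morphism quot_pi.
Proof. by split=> // x y; rewrite -quot_mulE. Qed.

HB.instance Definition _ :=
  GRing.isZmodMorphism.Build A quotAlg quot_pi quot_pi_zmod_morphism.
HB.instance Definition _ :=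
  GRing.isMonoidMorphism.Build A quotAlg quot_pi quot_pi_monoid_morphism.

Definition quot_algC (c : K) : quotAlg := quot_pi (kalgC c).

Lemma quot_algC_zmod : zmod_morphism quot_algC.
Proof. by move=> a b; rewrite /quot_algC kalgC_zmod rmorphB. Qed.

Lemma quot_algC_monoid : monoid_morphism quot_algC.
Proof.
by split=> [|a b]; rewrite /quot_algC kalgC_monoid ?rmorph1 ?rmorphM.
Qed.

Lemma quot_algC_comm (c : K) (x : quotAlg) : quot_algC c * x = x * quot_algC c.
Proof. by rewrite -[x]quot_reprK -!rmorphM kalgC_comm. Qed.

HB.instance Definition _ :=
  isKAlgebra.Build K quotAlg quot_algC_zmod quot_algC_monoid quot_algC_comm.

End Quotient.

(* mpoly redefines symmetric, and monalg redefines {mpoly R[n]}. *)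
From mathcomp.multinomials Require Import mpoly.

Section MPoly.
Variables (n : nat) (k : fieldType).

Lemma mpoly_algC_comm (c : k) (p : {mpoly k[n]}) : c%:A * p = p * c%:A.
Proof. exact: mulrC. Qed.

HB.instance Definition _ := isKAlgebra.Build k {mpoly k[n]}
  (rmorphB (GRing.in_alg {mpoly k[n]}))
  (rmorphism_monoidP (GRing.in_alg {mpoly k[n]})) mpoly_algC_comm.

End MPoly.

From mathcomp.multinomials Require Import monalg.

(* The free algebra on X is {malg k[{fmonom X}]}, the monoid algebra of the   *)
(* free monoid on X.                                                          *)
Section FreeAlgebra.
Variables (k : fieldType) (X : choiceType).
Implicit Types x : {malg k[{fmonom X}]}.

Lemma free_algC_comm (c : k) x : c%:A * x = x * c%:A.
Proof.
have -> : c%:A = mkmalgU mone c :> {malg k[{fmonom X}]}.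
  by rewrite -mul_malgC mulr1.
rewrite !malgM_def fgmulUg fgmulgU; apply: eq_bigr => m _.
by rewrite mul1m mulm1 mulrC.
Qed.

HB.instance Definition _ := isKAlgebra.Build k {malg k[{fmonom X}]}
  (rmorphB (GRing.in_alg {malg k[{fmonom X}]}))
  (rmorphism_monoidP (GRing.in_alg {malg k[{fmonom X}]})) free_algC_comm.

Definition free_gen (t : X) : {malg k[{fmonom X}]} := mkmalgU (fmu t) 1.

End FreeAlgebra.

Section PathAlgebra.
Variables (V : finType) (arrow : rel V) (k : fieldType).
Local Notation qpath := (qpath arrow).

Local Notation pathMod := {malg k[qpath]}.

(* the path with the given vertices, or 0 if they do not form a path *)
Definition pathv (v : V) (s : seq V) : pathMod :=
  if insub (v, s) is Some p then mkmalgU (p : qpath) 1 else 0.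

(* (i_r|...|i_1) (j_s|...|j_1) is (i_r|...|i_1|j_(s-1)|...|j_1) if i_1 = j_s, *)
(* and 0 otherwise.                                                           *)
Definition path_concat (p q : qpath) : pathMod :=
  if qpath_start p == qpath_end q then pathv (val p).1 ((val p).2 ++ (val q).2)
  else 0.

Definition path_mul (x y : pathMod) : pathMod :=
  \sum_(p <- msupp x) \sum_(q <- msupp y)
    (mcoeff p x * mcoeff q y) *: path_concat p q.

Definition path_one : pathMod := \sum_(v : V) pathv v [::].

Definition pathU (p : qpath) : pathMod := mkmalgU p 1.

Lemma pathv_val (p : qpath) : pathv (val p).1 (val p).2 = pathU p.
Proof. by rewrite /pathv -surjective_pairing valK. Qed.

Lemma path_mulEw (d1 d2 : {fset qpath}) (x y : pathMod) :
    fsubset (msupp x) d1 -> fsubset (msupp y) d2 ->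
  path_mul x y = \sum_(p <- d1) \sum_(q <- d2)
    (mcoeff p x * mcoeff q y) *: path_concat p q.
Proof.
move=> le1 le2; rewrite /path_mul (big_fset_incl _ le1) /=.
  apply: eq_bigr => p _; apply: big_fset_incl => // q _ /mcoeff_outdom ->.
  by rewrite mulr0 scale0r.
move=> p _ /mcoeff_outdom ->.
by rewrite big1 // => q _; rewrite mul0r scale0r.
Qed.

Lemma path_mulDl : left_distributive path_mul +%R.
Proof.
move=> x y z; pose d := fsetU (msupp x) (msupp y).
have rz := fsubset_refl (msupp z).
rewrite (path_mulEw (msuppD_le x y : fsubset _ d) rz).
rewrite (path_mulEw (fsubsetUl _ _ : fsubset (msupp x) d) rz).
rewrite (path_mulEw (fsubsetUr _ _ : fsubset (msupp y) d) rz).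
rewrite -big_split; apply: eq_bigr => p _; rewrite -big_split /=.
by apply: eq_bigr => q _; rewrite mcoeffD mulrDl scalerDl.
Qed.

Lemma path_mulDr : right_distributive path_mul +%R.
Proof.
move=> z x y; pose d := fsetU (msupp x) (msupp y).
have rz := fsubset_refl (msupp z).
rewrite (path_mulEw rz (msuppD_le x y : fsubset _ d)).
rewrite (path_mulEw rz (fsubsetUl _ _ : fsubset (msupp x) d)).
rewrite (path_mulEw rz (fsubsetUr _ _ : fsubset (msupp y) d)).
rewrite -big_split; apply: eq_bigr => p _; rewrite -big_split /=.
by apply: eq_bigr => q _; rewrite mcoeffD mulrDr scalerDl.
Qed.

Lemma path_mul0l x : path_mul 0 x = 0.
Proof. by apply: (addrI (path_mul 0 x)); rewrite -path_mulDl !addr0. Qed.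

Lemma path_mul0r x : path_mul x 0 = 0.
Proof. by apply: (addrI (path_mul x 0)); rewrite -path_mulDr !addr0. Qed.

Lemma path_mulZl a x y : path_mul (a *: x) y = a *: path_mul x y.
Proof.
rewrite (path_mulEw (msuppZ_le a x) (fsubset_refl _)).
rewrite /path_mul scaler_sumr; apply: eq_bigr => p _.
rewrite scaler_sumr; apply: eq_bigr => q _.
by rewrite scalerA mulrA mcoeffZ.
Qed.

Lemma path_mulZr a x y : path_mul x (a *: y) = a *: path_mul x y.
Proof.
rewrite (path_mulEw (fsubset_refl _) (msuppZ_le a y)).
rewrite /path_mul scaler_sumr; apply: eq_bigr => p _.
rewrite scaler_sumr; apply: eq_bigr => q _.
by rewrite scalerA mcoeffZ mulrCA.
Qed.

Lemma path_mulUU p q : path_mul (pathU p) (pathU q) = path_concat p q.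
Proof.
rewrite (@path_mulEw (fset1 p) (fset1 q) _ _ msuppU_le msuppU_le).
by rewrite !big_seq_fset1 [mcoeff p _]mcoeffUU [mcoeff q _]mcoeffUU mulr1 scale1r.
Qed.

Lemma pathMod_ind (P : pathMod -> Prop) :
    P 0 -> (forall x y, P x -> P y -> P (x + y)) ->
    (forall a p, P (a *: pathU p)) ->
  forall x, P x.
Proof.
move=> P0 PD PU x; rewrite [x]monalgE; apply: big_ind => // p _.
have -> : mkmalgU p (mcoeff p x) = mcoeff p x *: pathU p; last exact: PU.
apply/malgP => q; rewrite [RHS]mcoeffZ [LHS]mcoeffU [in RHS]mcoeffU.
by rewrite mulrnAr mulr1.
Qed.

Lemma path_mul_vv u s v t :
    path (fun v u => arrow u v) u s -> path (fun v u => arrow u v) v t ->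
  path_mul (pathv u s) (pathv v t) =
    if last u s == v then pathv u (s ++ t) else 0.
Proof.
move=> us vt.
have := path_mulUU (@QPath _ _ (u, s) us) (@QPath _ _ (v, t) vt).
by rewrite -!pathv_val.
Qed.

Lemma path_mulUA p q r :
  path_mul (pathU p) (path_mul (pathU q) (pathU r)) =
  path_mul (path_mul (pathU p) (pathU q)) (pathU r).
Proof.
rewrite -!pathv_val; case: p q r => [[u s] us] [[v t] vt] [[w r] wr] /=.
rewrite /= in us vt wr.
have := path_mul0l; have := path_mul0r; have := path_mul_vv.
move: path_mul pathv => mul pv mul_vv mul0r mul0l.
rewrite (mul_vv _ _ _ _ vt wr) (mul_vv _ _ _ _ us vt).
have [tw|tw] := eqVneq (last v t) w; have [sv|sv] := eqVneq (last u s) v.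
- rewrite !mul_vv ?cat_path ?sv ?tw ?us ?vt //.
  by rewrite last_cat sv tw !eqxx catA.
- by rewrite mul_vv ?cat_path ?tw ?vt // (negPf sv) mul0l.
- by rewrite mul_vv ?cat_path ?sv ?us // last_cat sv (negPf tw) mul0r.
by rewrite mul0l mul0r.
Qed.

Lemma path_mulA : associative path_mul.
Proof.
exact: (bilinear_mulA pathMod_ind path_mulDl path_mulDr path_mulZl path_mulZr
  path_mulUA).
Qed.

Lemma path_mul_suml (I : Type) (r : seq I) (F : I -> pathMod) y :
  path_mul (\sum_(i <- r) F i) y = \sum_(i <- r) path_mul (F i) y.
Proof.
exact: (big_morph (path_mul^~ y) (fun _ _ => path_mulDl _ _ _) (path_mul0l y)).
Qed.

Lemma path_mul_sumr (I : Type) (r : seq I) (F : I -> pathMod) x :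
  path_mul x (\sum_(i <- r) F i) = \sum_(i <- r) path_mul x (F i).
Proof.
exact: (big_morph (path_mul x) (fun _ _ => path_mulDr _ _ _) (path_mul0r x)).
Qed.

Lemma path_mul1U p : path_mul path_one (pathU p) = pathU p.
Proof.
rewrite -pathv_val path_mul_suml; case: p => [[u s] us]; rewrite /= in us *.
have := path_mul_vv; move: path_mul pathv => mul pv mul_vv.
rewrite (bigD1 u) //= mul_vv //= eqxx.
by rewrite big1 ?addr0 // => v /negPf vu; rewrite mul_vv //= vu.
Qed.

Lemma path_mulU1 p : path_mul (pathU p) path_one = pathU p.
Proof.
rewrite -pathv_val path_mul_sumr; case: p => [[u s] us]; rewrite /= in us *.
have := path_mul_vv; move: path_mul pathv => mul pv mul_vv.
rewrite (bigD1 (last u s)) //= mul_vv //= eqxx cats0.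
by rewrite big1 ?addr0 // => v /negPf vu; rewrite mul_vv //= eq_sym vu.
Qed.

Lemma path_mul1l : left_id path_one path_mul.
Proof.
elim/pathMod_ind => [|x y IHx IHy|a p]; first exact: path_mul0r.
  by rewrite path_mulDr IHx IHy.
by rewrite path_mulZr path_mul1U.
Qed.

Lemma path_mul1r : right_id path_one path_mul.
Proof.
elim/pathMod_ind => [|x y IHx IHy|a p]; first exact: path_mul0l.
  by rewrite path_mulDl IHx IHy.
by rewrite path_mulZl path_mulU1.
Qed.

(* The path algebra: the free module on the paths, with product path_mul. *)
Definition pathAlg : Type := pathMod.
HB.instance Definition _ := GRing.Lmodule.copy pathAlg pathMod.

HB.instance Definition _ := GRing.Zmodule_isPzRing.Build pathAlg
  path_mulA path_mul1l path_mul1r path_mulDl path_mulDr.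

Definition path_algC (c : k) : pathAlg := (c *: path_one : pathMod).

Lemma path_algC_zmod : zmod_morphism path_algC.
Proof. exact: (fun a b => scalerBl a b path_one). Qed.

Lemma path_algC_monoid : monoid_morphism path_algC.
Proof.
split=> [|a b]; first exact: (scale1r path_one).
rewrite [RHS](path_mulZl a path_one (b *: path_one)) path_mul1l.
by rewrite [RHS]scalerA.
Qed.

Lemma path_algC_comm (c : k) (x : pathAlg) : path_algC c * x = x * path_algC c.
Proof.
rewrite [LHS](path_mulZl c path_one x) [RHS](path_mulZr c x path_one).
by rewrite path_mul1l path_mul1r.
Qed.

HB.instance Definition _ :=
  isKAlgebra.Build k pathAlg path_algC_zmod path_algC_monoid path_algC_comm.

End PathAlgebra.

(* The algebra W(n,1). The indices 1, ..., n+1 of the e_i and y_j are 'I_n.+1 *)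
(* shifted by one, and the indices 1, ..., n of the psi_j are 'I_n; for       *)
(* j : 'I_n, idx j and idxS j in 'I_n.+1 stand for the indices j and j+1.     *)
(* The degrees 0, 2 and 1 of e_i, y_j and psi_j make all relations            *)
(* homogeneous; only the underlying ungraded algebra is defined.              *)
Section Webster.
Variables (k : fieldType) (n : nat).

Definition Wgen : choiceType := ('I_n.+1 + 'I_n.+1 + 'I_n)%type.

Definition Wfree := {malg k[{fmonom Wgen}]}.

Definition gen_e (i : 'I_n.+1) : Wfree := free_gen k (inl (inl i) : Wgen).
Definition gen_y (i : 'I_n.+1) : Wfree := free_gen k (inl (inr i) : Wgen).
Definition gen_psi (j : 'I_n) : Wfree := free_gen k (inr j : Wgen).

Definition idx (j : 'I_n) : 'I_n.+1 := widen_ord (leqnSn n) j.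
Definition idxS (j : 'I_n) : 'I_n.+1 := lift ord0 j.

(* a relation lhs = rhs is recorded as lhs - rhs *)
Inductive Wrel : Wfree -> Prop :=
| Wrel_ee i j : Wrel (gen_e i * gen_e j - (i == j)%:R * gen_e i)
| Wrel_sum_e : Wrel ((\sum_i gen_e i) - 1)
| Wrel_ye i j : Wrel (gen_y j * gen_e i - gen_e i * gen_y j)
| Wrel_yy j l : Wrel (gen_y j * gen_y l - gen_y l * gen_y j)
| Wrel_psie0 i j of i != idx j & i != idxS j : Wrel (gen_psi j * gen_e i - 0)
| Wrel_psie j :
    Wrel (gen_psi j * gen_e (idx j) - gen_e (idxS j) * gen_psi j)
| Wrel_psieS j :
    Wrel (gen_psi j * gen_e (idxS j) - gen_e (idx j) * gen_psi j)
| Wrel_psipsi (j l : 'I_n) of (j.+1 < l)%N || (l.+1 < j)%N :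
    Wrel (gen_psi j * gen_psi l - gen_psi l * gen_psi j)
| Wrel_psiy j l of l != idx j & l != idxS j :
    Wrel (gen_psi j * gen_y l - gen_y l * gen_psi j)
| Wrel_psiyl j : Wrel (gen_psi j * gen_y (idx j) - gen_y (idxS j) * gen_psi j)
| Wrel_psiyr j : Wrel (gen_y (idx j) * gen_psi j - gen_psi j * gen_y (idxS j))
| Wrel_psi2 j :
    Wrel (gen_psi j ^+ 2 * gen_e (idx j)
          - (gen_y (idx j) - gen_y (idxS j)) * gen_e (idx j))
| Wrel_psi2S j :
    Wrel (gen_psi j ^+ 2 * gen_e (idxS j)
          - (gen_y (idxS j) - gen_y (idx j)) * gen_e (idxS j))
| Wrel_braid (j l : 'I_n) of l = j.+1 :> nat :
    Wrel (gen_psi j * gen_psi l * gen_psi j - gen_psi l * gen_psi j * gen_psi l)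
| Wrel_e1 : Wrel (gen_e ord0 - 0).

Definition W : kalgType k := quotAlg Wrel.

Definition We (i : 'I_n.+1) : W := quot_pi Wrel (gen_e i).
Definition Wy (i : 'I_n.+1) : W := quot_pi Wrel (gen_y i).

(* the image of x_l in W(n,1) *)
Definition Wx (l : 'I_n) : W :=
  \sum_(i < n.+1 | (l < i)%N) Wy (idx l) * We i
  + \sum_(i < n.+1 | (i <= l)%N) Wy (idxS l) * We i.

End Webster.

(* The algebra A_n^!, with vertices 1, ..., n numbered from 0. *)
Section AnDual.
Variables (k : fieldType) (n : nat).

Definition An_arrow : rel 'I_n :=
  fun i j => (j == i.+1 :> nat) || (i == j.+1 :> nat).

(* (i|i-1|i) - (i|i+1|i), without the first term when i is the first vertex *)
Inductive An_rel : pathAlg An_arrow k -> Prop :=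
| An_rel_first (i j : 'I_n) of i = 0%N :> nat & j = i.+1 :> nat :
    An_rel (0 - pathv An_arrow k i [:: j; i])
| An_rel_next (h i j : 'I_n) of i = h.+1 :> nat & j = i.+1 :> nat :
    An_rel (pathv An_arrow k i [:: h; i] - pathv An_arrow k i [:: j; i]).

Definition An_dual : kalgType k := quotAlg An_rel.

End AnDual.

(* Main.v *)
Require Import Defs.
From mathcomp Require Import all_boot all_order all_algebra.
From mathcomp Require boolp cardinality classical_sets.
From mathcomp Require Import finmap.
From mathcomp.multinomials Require Import mpoly.
From mathcomp.multinomials Require monalg ssrcomplements.
From HB Require Import structures.
From mathcomp Require Import zify.

Set Implicit Arguments.
Unset Strict Implicit.
Unset Printing Implicit Defensive.

Import GRing.Theory.
Local Open Scope ring_scope.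

(** Since [psi_j e_i = 0] unless [i] is [j] or [j+1], the algebra W(n,1) lives
    on the double quiver of type A whose vertices are the nonzero idempotents
    [e_2, ..., e_{n+1}], with arrows [e_{j+1} psi_j e_j] and
    [e_j psi_j e_{j+1}].  On the vertex [e_i] the elements [y_l], [l != i], act
    by the central elements [x_1, ..., x_n], so that a single new loop
    [y_i e_i] remains.  Modulo the [x_l], the relations for [psi_j^2] say that
    every length-two loop at the vertex [e_i] equals [y_i e_i], and at [e_2] one
    such loop passes through [e_1 = 0]: these are the defining relations of
    A_n^!.

    The isomorphism is obtained from two mutually inverse morphisms, each
    given by a universal property and compared on generators.
    - [An_W_relations]: W(n,1) acts through A_n^!, with [psi_j] sent to the sum
      of the two arrows between the vertices [j-1] and [j], and [y_i] to the
      loop at [i-1]; [An_x0] says that the [x_l] die, so this factors through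
      the quotient.
    - [An_lift]: conversely, any elements that satisfy the relations of W(n,1)
      and have [x_l = 0] define a morphism from A_n^!.
    [W_psi_split], [W_up_down] and [W_y_eq_ye] show that one composite is the
    identity, [An_up_split] and [An_dn_split] do so for the other.

    The map from [k[x_1, ..., x_n]] exists because the [x_l] commute
    ([x_elt_comm]).  It is injective because it has a retraction, the character
    of W(n,1) on the last vertex: [e_{n+1}] goes to [1], the other idempotents
    and all [psi_j] to [0], [y_l] to [X_l] and [y_{n+1}] to [X_n]
    ([ret_W_relations], [ret_x]). *)

(** * Morphisms of algebras *)

Section Morphisms.
Variables (K : comPzRingType) (A B : kalgType K) (f : A -> B).
Hypothesis fM : kalg_morphism f.

Let f_zmod : zmod_morphism f.
Proof.
by have [fD _ _] := fM; move=> x y; rewrite -{2}(subrK y x) (fD (x - y)) addrK.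
Qed.

Let f_monoid : monoid_morphism f.
Proof.
have [_ fm fC] := fM; split=> //.
by have := fC 1; rewrite !kalgC_monoid.
Qed.

(** This gives access to the generic theory of ring morphisms. *)
Definition kalg_rmorphism : {rmorphism A -> B} :=
  HB.pack f (GRing.isZmodMorphism.Build A B f f_zmod)
            (GRing.isMonoidMorphism.Build A B f f_monoid).

Lemma kalgmD : {morph f : x y / x + y}. Proof. by case: fM. Qed.
Lemma kalgmM : {morph f : x y / x * y}. Proof. by case: fM. Qed.
Lemma kalgmC c : f (kalgC c) = kalgC c. Proof. by case: fM. Qed.
Lemma kalgm0 : f 0 = 0. Proof. exact: (rmorph0 kalg_rmorphism). Qed.
Lemma kalgm1 : f 1 = 1. Proof. exact: (rmorph1 kalg_rmorphism). Qed.
Lemma kalgmB : {morph f : x y / x - y}. Proof. exact: (rmorphB kalg_rmorphism). Qed.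
Lemma kalgm_nat m : f m%:R = m%:R. Proof. exact: (rmorph_nat kalg_rmorphism). Qed.
Lemma kalgmX m : {morph f : x / x ^+ m}. Proof. exact: (rmorphXn kalg_rmorphism). Qed.
Lemma kalgm_sum (I : Type) (r : seq I) (P : pred I) (F : I -> A) :
  f (\sum_(i <- r | P i) F i) = \sum_(i <- r | P i) f (F i).
Proof. exact: (rmorph_sum kalg_rmorphism). Qed.
End Morphisms.

Lemma kalgm_comp (K : comPzRingType) (A B C : kalgType K) (f : A -> B)
    (g : B -> C) :
  kalg_morphism f -> kalg_morphism g -> kalg_morphism (g \o f).
Proof.
move=> [fD fm fC] [gD gm gC].
by split=> [x y|x y|c] /=; rewrite ?(fD, gD) ?(fm, gm) // fC gC.
Qed.

(** * Universal properties of quotients, free algebras, path algebras and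
      polynomial rings *)

Section QuotientLift.
Variables (K : comPzRingType) (A B : kalgType K) (S : A -> Prop).

Lemma quot_pi_kalgm : kalg_morphism (quot_pi S).
Proof. by split=> // x y; rewrite ?rmorphD ?rmorphM. Qed.

Lemma quot_lift (f : A -> B) :
    kalg_morphism f -> (forall x, S x -> f x = 0) ->
  exists2 g : quotAlg S -> B, kalg_morphism g & forall x, g (quot_pi S x) = f x.
Proof.
move=> fM fS.
have f0 x : ideal_gen S x -> f x = 0.
  elim=> {x} [x /fS //||x y _ fx _ fy|a x _ fx|x a _ fx].
  - exact: kalgm0.
  - by rewrite kalgmD // fx fy addr0.
  - by rewrite kalgmM // fx mulr0.
  - by rewrite kalgmM // fx mul0r.
pose g (x : quotAlg S) := f (repr x).
have gE x : g (quot_pi S x) = f x.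
  apply/eqP; rewrite -subr_eq0 -(kalgmB fM); apply/eqP/f0.
  exact: ideal_repr.
exists g => //; split=> [x y|x y|c]; last by rewrite gE kalgmC.
  by rewrite -[x]quot_reprK -[y]quot_reprK -rmorphD !gE kalgmD.
by rewrite -[x]quot_reprK -[y]quot_reprK -rmorphM !gE kalgmM.
Qed.

Lemma quot_pi_surj (x : quotAlg S) : exists y, x = quot_pi S y.
Proof. by exists (repr x); rewrite quot_reprK. Qed.

End QuotientLift.

Section ScalarAlgebra.
Variables (K : comPzRingType) (B : kalgType K).

Lemma kalgC0 : kalgC 0 = 0 :> B.
Proof. by have := @kalgC_zmod K B 0 0; rewrite !subrr. Qed.

Lemma kalgC1 : kalgC 1 = 1 :> B.
Proof. exact: (@kalgC_monoid K B).1. Qed.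

Lemma kalgCM a b : kalgC (a * b) = kalgC a * kalgC b :> B.
Proof. exact: (@kalgC_monoid K B).2. Qed.

Lemma kalgCD a b : kalgC (a + b) = kalgC a + kalgC b :> B.
Proof.
by have := @kalgC_zmod K B (a + b) b; rewrite addrK => ->; rewrite subrK.
Qed.

End ScalarAlgebra.

Section LinearExtension.
(* In this section and in those below that start in the same way, the names
   shared with mpoly denote the notions of monalg. *)
Import monalg.
Variables (k : fieldType) (T : choiceType) (B : kalgType k) (h : T -> B).
Local Notation L := {malg k[T]}.
Local Notation supp := (@monalg.msupp T k).
Local Notation coef := (@monalg.mcoeff T k).

Definition malg_ext (x : L) : B := \sum_(t <- supp x) kalgC (coef t x) * h t.

Lemma malg_extEw (d : {fset T}) (x : L) : fsubset (supp x) d ->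
  malg_ext x = \sum_(t <- d) kalgC (coef t x) * h t.
Proof.
move=> le; rewrite /malg_ext (big_fset_incl _ le) //= => t _ /mcoeff_outdom ->.
by rewrite kalgC0 mul0r.
Qed.

Lemma malg_extD : {morph malg_ext : x y / x + y}.
Proof.
move=> x y; rewrite (malg_extEw (monalg.msuppD_le x y)).
rewrite (malg_extEw (fsubsetUl (supp x) (supp y))).
rewrite (malg_extEw (fsubsetUr (supp x) (supp y))) -big_split /=.
by apply: eq_bigr => t _; rewrite monalg.mcoeffD kalgCD mulrDl.
Qed.

Lemma malg_extZ c x : malg_ext (c *: x) = kalgC c * malg_ext x.
Proof.
rewrite (malg_extEw (monalg.msuppZ_le c x)) /malg_ext mulr_sumr.
by apply: eq_bigr => t _; rewrite monalg.mcoeffZ kalgCM mulrA.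
Qed.

Lemma malg_ext0 : malg_ext 0 = 0.
Proof. by rewrite -(scale0r 0) malg_extZ kalgC0 mul0r. Qed.

Lemma malg_extU t : malg_ext (mkmalgU t 1) = h t.
Proof.
rewrite (malg_extEw monalg.msuppU_le) big_seq_fset1 mcoeffUU.
by rewrite kalgC1 mul1r.
Qed.

Lemma malg_ind (P : L -> Prop) :
    P 0 -> (forall x y, P x -> P y -> P (x + y)) ->
    (forall c t, P (c *: mkmalgU t 1)) ->
  forall x, P x.
Proof.
move=> P0 PD PU x; rewrite [x]monalgE; apply: big_ind => // t _.
suff -> : mkmalgU t (coef t x) = coef t x *: mkmalgU t 1 by exact: PU.
by apply/malgP => u; rewrite monalg.mcoeffZ !mcoeffU mulrnAr mulr1.
Qed.

(** Multiplicativity of a linear extension needs checking on basis elements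
    only.  The product is a parameter because the free algebra and the path
    algebra are free modules with different products. *)
Lemma malg_ext_mul (mul : L -> L -> L) :
    left_distributive mul +%R -> right_distributive mul +%R ->
    (forall c x y, mul (c *: x) y = c *: mul x y) ->
    (forall c x y, mul x (c *: y) = c *: mul x y) ->
    (forall t u, malg_ext (mul (mkmalgU t 1) (mkmalgU u 1)) = h t * h u) ->
  forall x y, malg_ext (mul x y) = malg_ext x * malg_ext y.
Proof.
move=> mDl mDr mZl mZr mU.
have m0l y : mul 0 y = 0 by rewrite -[in LHS](scale0r 0) mZl scale0r.
have m0r x : mul x 0 = 0 by rewrite -[in LHS](scale0r 0) mZr scale0r.
move=> x; elim/malg_ind: x => [y|x1 x2 IH1 IH2 y|c t].
- by rewrite m0l malg_ext0 mul0r.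
- by rewrite mDl !malg_extD mulrDl IH1 IH2.
elim/malg_ind => [|y1 y2 IH1 IH2|d u].
- by rewrite m0r malg_ext0 mulr0.
- by rewrite mDr !malg_extD mulrDr IH1 IH2.
rewrite mZl mZr !malg_extZ mU !malg_extU -!mulrA; congr (_ * _).
by rewrite mulrA kalgC_comm -mulrA.
Qed.

End LinearExtension.

Section FreeAlgebra.
Import monalg.
Variables (k : fieldType) (X : choiceType).
Local Notation F := {malg k[{fmonom X}]}.

Lemma free_scaleE (c : k) (x : F) : c *: x = kalgC c * x.
Proof. by rewrite -[in LHS](mul1r x) scalerAl. Qed.

Lemma free_genM (m1 m2 : {fmonom X}) :
  mkmalgU m1 1 * mkmalgU m2 1 = mkmalgU (mmul m1 m2) 1 :> F.
Proof. by rewrite malgM_def fgmulUU mulr1. Qed.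

Lemma free_lift (B : kalgType k) (h : X -> B) :
  exists2 g : F -> B, kalg_morphism g & forall t, g (free_gen k t) = h t.
Proof.
pose hm (m : {fmonom X}) := \prod_(t <- (m : seq X)) h t.
exists (malg_ext hm); last first.
  by move=> t; rewrite malg_extU /hm fmU big_seq1.
split=> [||c]; first exact: malg_extD.
  apply: (malg_ext_mul (mul := *%R)) => [x y z|x y z|c x y|c x y|t u].
  - exact: mulrDl.
  - exact: mulrDr.
  - by rewrite scalerAl.
  - by rewrite !free_scaleE mulrA -kalgC_comm mulrA.
  by rewrite free_genM malg_extU /hm fmM big_cat.
have -> : kalgC c = c *: mkmalgU mone 1 :> F by [].
by rewrite malg_extZ malg_extU /hm fm1 big_nil mulr1.
Qed.

Lemma free_eq (B : kalgType k) (f g : F -> B) :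
    kalg_morphism f -> kalg_morphism g ->
    (forall t, f (free_gen k t) = g (free_gen k t)) ->
  f =1 g.
Proof.
move=> fM gM fg; elim/malg_ind => [|x y IHx IHy|c [s]].
- by rewrite !kalgm0.
- by rewrite !kalgmD // IHx IHy.
rewrite free_scaleE !kalgmM // !kalgmC //; congr (_ * _).
elim: s => [|t s IHs].
  by rewrite -fmoneE; rewrite (kalgm1 fM) (kalgm1 gM).
suff -> : mkmalgU (FMonom (t :: s)) 1 = free_gen k t * mkmalgU (FMonom s) 1 :> F.
  by rewrite !kalgmM // fg IHs.
by rewrite free_genM fmuE /mmul /= fmmulE.
Qed.

End FreeAlgebra.

Section PathAlgebra.
Import monalg.
Variables (V : finType) (arrow : rel V) (k : fieldType).
Local Notation PA := (pathAlg arrow k).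
Local Notation pv v s := (pathv arrow k v s : PA).
Local Notation is_path := (path (fun v u => arrow u v)).

Lemma pathvM (u : V) s (v : V) t : is_path u s -> is_path v t ->
  pv u s * pv v t = if last u s == v then pv u (s ++ t) else 0.
Proof. exact: path_mul_vv. Qed.

Lemma path_scaleE (c : k) (x : PA) : c *: x = kalgC c * x.
Proof.
by rewrite -[in LHS](path_mul1l x); symmetry; apply: (path_mulZl c (path_one _ k) x).
Qed.

Lemma pathAlg_ind (P : PA -> Prop) :
    P 0 -> (forall x y, P x -> P y -> P (x + y)) ->
    (forall c v s, is_path v s -> P (kalgC c * pv v s)) ->
  forall x, P x.
Proof.
move=> P0 PD PU; apply: pathMod_ind => // c p.
rewrite -pathv_val [_ *: _]path_scaleE; case: p => -[v s] /= vs; exact: PU.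
Qed.

Lemma path_eq (B : kalgType k) (f g : PA -> B) :
    kalg_morphism f -> kalg_morphism g ->
    (forall v, f (pv v [::]) = g (pv v [::])) ->
    (forall v u, arrow u v -> f (pv v [:: u]) = g (pv v [:: u])) ->
  f =1 g.
Proof.
move=> fM gM fg0 fg1; elim/pathAlg_ind => [|x y IHx IHy|c v s vs].
- by rewrite !kalgm0.
- by rewrite !kalgmD // IHx IHy.
rewrite !kalgmM // !kalgmC //; congr (_ * _).
elim: s v vs => [|u s IHs] v //= /andP[uv us].
have -> : pv v (u :: s) = pv v [:: u] * pv u s.
  by rewrite pathvM //= ?uv // eqxx.
by rewrite !kalgmM // fg1 // IHs.
Qed.

(** A morphism out of a path algebra amounts to a complete family of orthogonal
    idempotents [E] and, for each arrow, an element lying between the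
    idempotents of its ends.  It is convenient to choose [a v u] for all pairs
    of vertices. *)
Section Lift.
Variables (B : kalgType k) (E : V -> B) (a : V -> V -> B).
Hypothesis EE : forall u v, E u * E v = if u == v then E u else 0.
Hypothesis sumE : \sum_v E v = 1.
Hypothesis aE : forall v u, E v * a v u * E u = a v u.

Fixpoint path_value (v : V) (s : seq V) : B :=
  if s is u :: s' then a v u * path_value u s' else E v.

Lemma path_valueM u s v t :
  path_value u s * path_value v t =
    if last u s == v then path_value u (s ++ t) else 0.
Proof.
elim: s u => [|w s IHs] u /=; last first.
  by rewrite -mulrA IHs; case: ifP => // _; rewrite mulr0.
case: t => [|w t] /=; first by rewrite EE; case: eqP.
rewrite -(aE v w) !mulrA EE; case: eqP => [->|_]; last by rewrite !mul0r.
by rewrite aE.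
Qed.

Lemma path_lift :
  exists2 g : PA -> B, kalg_morphism g &
    forall v s, is_path v s -> g (pv v s) = path_value v s.
Proof.
pose h (p : qpath arrow) := path_value (val p).1 (val p).2.
pose g (x : PA) : B := malg_ext h x.
have gv v s : is_path v s -> g (pv v s) = path_value v s.
  move=> vs; have := pathv_val k (@QPath _ _ (v, s) vs) => /= ->.
  by rewrite /g malg_extU.
exists g => //; split=> [||c]; first exact: malg_extD.
  apply: (malg_ext_mul (mul := @path_mul V arrow k)) => [x y z|x y z|c x y|c x y|p q].
  - exact: path_mulDl.
  - exact: path_mulDr.
  - exact: path_mulZl.
  - exact: path_mulZr.
  rewrite -!/(pathU k _) -!pathv_val; case: p q => [[u s] us] [[v t] vt].
  rewrite /= in us vt *; rewrite path_mul_vv // path_valueM.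
  case: eqP => [suv|_]; last exact: malg_ext0.
  by apply: gv; rewrite cat_path us suv.
rewrite [LHS](malg_extZ h c (path_one arrow k)).
suff -> : malg_ext h (path_one arrow k) = 1 by rewrite mulr1.
rewrite -sumE /path_one (big_morph _ (malg_extD h) (malg_ext0 h)).
by apply: eq_bigr => v _; apply: gv.
Qed.

End Lift.
End PathAlgebra.

Section Polynomials.
Variables (k : fieldType) (n : nat).
Local Notation P := {mpoly k[n]}.

Lemma mpoly_scaleE (c : k) (p : P) : c *: p = kalgC c * p.
Proof. by rewrite -[in LHS](mul1r p) scalerAl. Qed.

Lemma mpoly_kalgCE (c : k) : kalgC c = c%:MP :> P.
Proof. by rewrite -[RHS]mulr1 mul_mpolyC. Qed.

Lemma mpoly_sum_ind (Q : P -> Prop) :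
    Q 0 -> (forall x y, Q x -> Q y -> Q (x + y)) ->
    (forall c m, Q (c *: 'X_[m])) ->
  forall p, Q p.
Proof.
move=> Q0 QD QX; elim/mpolyind => // c m p _ _ Qp.
by apply: QD => //; apply: QX.
Qed.

Lemma mpoly_eq (B : kalgType k) (f g : P -> B) :
    kalg_morphism f -> kalg_morphism g ->
    (forall i, f 'X_i = g 'X_i) ->
  f =1 g.
Proof.
move=> fM gM fg; elim/mpoly_sum_ind => [|x y IHx IHy|c m].
- by rewrite !kalgm0.
- by rewrite !kalgmD // IHx IHy.
rewrite mpoly_scaleE !kalgmM // !kalgmC //; congr (_ * _).
rewrite mpolyXE_id [LHS](rmorph_prod (kalg_rmorphism fM)).
rewrite [RHS](rmorph_prod (kalg_rmorphism gM)); apply: eq_bigr => i _.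
by rewrite !rmorphXn /= fg.
Qed.

(** The target need not be commutative, so the chosen values have to commute. *)
Section Lift.
Variables (B : kalgType k) (x : 'I_n -> B).
Hypothesis x_comm : forall i j, GRing.comm (x i) (x j).

Definition monom_value (m : 'X_{1..n}) : B := \prod_(i < n) x i ^+ m i.
Definition mpoly_value (p : P) : B :=
  \sum_(m <- msupp p) kalgC p@_m * monom_value m.

(** Polynomials are added termwise once the monomials that occur are replaced by
    all those of bounded degree. *)
Lemma mpoly_valueE i p : (msize p <= i)%N ->
  mpoly_value p = \sum_(m : 'X_{1..n < i}) kalgC p@_m * monom_value m.
Proof.
move=> le_pi; rewrite /mpoly_value.
rewrite (ssrcomplements.big_mksub 'X_{1..n < i}) ?msupp_uniq //=.
  rewrite big_rmcond //= => j /memN_msupp_eq0 ->.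
  by rewrite kalgC0 mul0r.
by move=> m /msize_mdeg_lt /leq_trans; apply.
Qed.

(** The factors of the two products are interleaved one index at a time, moving
    each power of [x i] across the remaining factors. *)
Lemma monom_valueM m1 m2 :
  monom_value (m1 + m2) = monom_value m1 * monom_value m2.
Proof.
rewrite /monom_value.
rewrite [LHS](_ : _ = \prod_(i < n) (x i ^+ m1 i * x i ^+ m2 i)); last first.
  by apply: eq_bigr => i _; rewrite mnmDE exprD.
elim: (index_enum _) => [|i s IHs]; first by rewrite !big_nil mulr1.
rewrite !big_cons IHs // -!mulrA; congr (_ * _); rewrite !mulrA; congr (_ * _).
elim: s {IHs} => [|j s IHs]; first by rewrite big_nil mulr1 mul1r.
rewrite big_cons mulrA [_ ^+ _ * _](_ : _ = x j ^+ m1 j * x i ^+ m2 i).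
  by rewrite -!mulrA IHs.
exact/commrX/commr_sym/commrX.
Qed.

Lemma mpoly_lift :
  exists2 g : P -> B, kalg_morphism g & forall i, g 'X_i = x i.
Proof.
have gD : {morph mpoly_value : p q / p + q}.
  move=> p q; pose i := maxn (msize (p + q)) (maxn (msize p) (msize q)).
  rewrite !(@mpoly_valueE i) ?leq_max ?leqnn ?orbT // -big_split /=.
  by apply: eq_bigr => m _; rewrite mcoeffD kalgCD mulrDl.
have gZ c p : mpoly_value (c *: p) = kalgC c * mpoly_value p.
  pose i := maxn (msize (c *: p)) (msize p).
  rewrite !(@mpoly_valueE i) ?leq_max ?leqnn ?orbT // mulr_sumr.
  by apply: eq_bigr => m _; rewrite mcoeffZ kalgCM mulrA.
have g0 : mpoly_value 0 = 0 by rewrite -[in LHS](scale0r 0) gZ kalgC0 mul0r.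
have gX m : mpoly_value 'X_[m] = monom_value m.
  by rewrite /mpoly_value msuppX big_seq1 mcoeffX eqxx kalgC1 mul1r.
exists mpoly_value; last first.
  move=> i; rewrite gX /monom_value -[RHS](big_pred1_eq *%R i x) big_mkcond.
  by apply: eq_bigr => j _; rewrite mnm1E eq_sym; case: eqP.
split=> // [p q|c]; last first.
  rewrite mpoly_kalgCE -[c]mulr1 mpolyCM mul_mpolyC mpolyC1 gZ -mpolyX0 gX.
  by rewrite /monom_value big1 ?kalgCM ?kalgC1 // => i _; rewrite mnm0E.
elim/mpoly_sum_ind: p => [|p1 p2 IH1 IH2|c m].
- by rewrite mul0r g0 mul0r.
- by rewrite mulrDl !gD IH1 IH2 mulrDl.
elim/mpoly_sum_ind: q => [|q1 q2 IH1 IH2|d l].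
- by rewrite mulr0 g0 mulr0.
- by rewrite mulrDr !gD IH1 IH2 mulrDr.
rewrite -scalerAl -scalerAr !gZ -mpolyXD !gX monom_valueM -!mulrA.
by congr (_ * _); rewrite mulrA kalgC_comm -mulrA.
Qed.

End Lift.
End Polynomials.

(** * The presentation of W(n,1) *)

Section WebsterPresentation.
Import monalg.
Variables (k : fieldType) (n : nat).
Local Notation idx := (@idx n).
Local Notation idxS := (@idxS n).

(** The relations of W(n,1) for elements of an arbitrary algebra, so that maps
    out of W(n,1) and computations in its quotients use the same statement. *)
Record W_relations (B : kalgType k) (e y : 'I_n.+1 -> B) (psi : 'I_n -> B) :
    Prop := WRelations {
  W_ee : forall i j, e i * e j = (i == j)%:R * e i;
  W_sum_e : \sum_i e i = 1;
  W_ye : forall i j, y j * e i = e i * y j;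
  W_yy : forall i j, y i * y j = y j * y i;
  W_psie0 : forall i j, i != idx j -> i != idxS j -> psi j * e i = 0;
  W_psie : forall j, psi j * e (idx j) = e (idxS j) * psi j;
  W_psieS : forall j, psi j * e (idxS j) = e (idx j) * psi j;
  W_psipsi : forall j l : 'I_n, (j.+1 < l)%N || (l.+1 < j)%N ->
    psi j * psi l = psi l * psi j;
  W_psiy : forall j l, l != idx j -> l != idxS j -> psi j * y l = y l * psi j;
  W_psiyl : forall j, psi j * y (idx j) = y (idxS j) * psi j;
  W_psiyr : forall j, y (idx j) * psi j = psi j * y (idxS j);
  W_psi2 : forall j, psi j ^+ 2 * e (idx j) = (y (idx j) - y (idxS j)) * e (idx j);
  W_psi2S : forall j,
    psi j ^+ 2 * e (idxS j) = (y (idxS j) - y (idx j)) * e (idxS j);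
  W_braid : forall j l : 'I_n, l = j.+1 :> nat ->
    psi j * psi l * psi j = psi l * psi j * psi l;
  W_e1 : e ord0 = 0
}.

Local Notation ge := (gen_e k).
Local Notation gy := (gen_y k).
Local Notation gpsi := (@gen_psi k n).

Lemma W_relationsP (B : kalgType k) (f : Wfree k n -> B) :
    kalg_morphism f ->
  (forall x, Wrel x -> f x = 0) <->
  W_relations (fun i => f (ge i)) (fun i => f (gy i)) (fun j => f (gpsi j)).
Proof.
(* Rewriting folds [f a * f b] into [f (a * b)] and never the other way:
   looking for [f (_ * _)] would unfold the elements of the free algebra. *)
move=> fM; split=> [f0|[]].
  have fE u v : Wrel (u - v) -> f u = f v.
    by move=> /f0 /eqP; rewrite kalgmB // subr_eq0 => /eqP.
  split=> [i j||i j|i j|i j ij ijS|j|j|j l jl|j l lj ljS|j|j|j|j|j l jl|].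
  - by rewrite -(kalgm_nat fM) -!(kalgmM fM); apply/fE/Wrel_ee.
  - by rewrite -(kalgm_sum fM) -(kalgm1 fM); apply/fE/Wrel_sum_e.
  - by rewrite -!(kalgmM fM); apply/fE/Wrel_ye.
  - by rewrite -!(kalgmM fM); apply/fE/Wrel_yy.
  - by rewrite -!(kalgmM fM) -(kalgm0 fM); apply/fE/Wrel_psie0.
  - by rewrite -!(kalgmM fM); apply/fE/Wrel_psie.
  - by rewrite -!(kalgmM fM); apply/fE/Wrel_psieS.
  - by rewrite -!(kalgmM fM); apply/fE/Wrel_psipsi.
  - by rewrite -!(kalgmM fM); apply/fE/Wrel_psiy.
  - by rewrite -!(kalgmM fM); apply/fE/Wrel_psiyl.
  - by rewrite -!(kalgmM fM); apply/fE/Wrel_psiyr.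
  - by rewrite -(kalgmX fM) -(kalgmB fM) -!(kalgmM fM); apply/fE/Wrel_psi2.
  - by rewrite -(kalgmX fM) -(kalgmB fM) -!(kalgmM fM); apply/fE/Wrel_psi2S.
  - by rewrite -!(kalgmM fM); apply/fE/Wrel_braid.
  by rewrite -(kalgm0 fM); apply/fE/Wrel_e1.
move=> Ree Rse Rye Ryy Rpe0 Rpe RpeS Rpp Rpy Rpyl Rpyr Rp2 Rp2S Rbr Re1.
have fE u v : f u = f v -> f (u - v) = 0 by rewrite kalgmB // => ->; rewrite subrr.
move=> x.
case=> [i j||i j|i j|i j ij ijS|j|j|j l jl|j l lj ljS|j|j|j|j|j l jl|]; apply: fE.
- by have := Ree i j; rewrite -(kalgm_nat fM) -!(kalgmM fM).
- by have := Rse; rewrite -(kalgm_sum fM) -(kalgm1 fM).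
- by have := Rye i j; rewrite -!(kalgmM fM).
- by have := Ryy i j; rewrite -!(kalgmM fM).
- by have := Rpe0 _ _ ij ijS; rewrite -!(kalgmM fM) -(kalgm0 fM).
- by have := Rpe j; rewrite -!(kalgmM fM).
- by have := RpeS j; rewrite -!(kalgmM fM).
- by have := Rpp _ _ jl; rewrite -!(kalgmM fM).
- by have := Rpy _ _ lj ljS; rewrite -!(kalgmM fM).
- by have := Rpyl j; rewrite -!(kalgmM fM).
- by have := Rpyr j; rewrite -!(kalgmM fM).
- by have := Rp2 j; rewrite -(kalgmX fM) -(kalgmB fM) -!(kalgmM fM).
- by have := Rp2S j; rewrite -(kalgmX fM) -(kalgmB fM) -!(kalgmM fM).
- by have := Rbr _ _ jl; rewrite -!(kalgmM fM).
- by have := Re1; rewrite -(kalgm0 fM).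
Qed.

Definition Wpsi (j : 'I_n) : W k n := quot_pi _ (gpsi j).

Lemma W_relations_morph (B : kalgType k) (g : W k n -> B) : kalg_morphism g ->
  W_relations (fun i => g (We k i)) (fun i => g (Wy k i)) (fun j => g (Wpsi j)).
Proof.
move=> gM; apply/(W_relationsP (kalgm_comp (quot_pi_kalgm _) gM)) => x xR /=.
rewrite (_ : quot_pi _ x = 0) ?kalgm0 //.
rewrite -(kalgm0 (quot_pi_kalgm _)); apply/quot_piP; rewrite subr0.
exact: ideal_gen_in.
Qed.

Lemma W_lift (B : kalgType k) (e y : 'I_n.+1 -> B) (psi : 'I_n -> B) :
    W_relations e y psi ->
  exists2 g : W k n -> B, kalg_morphism g &
    [/\ forall i, g (We k i) = e i, forall i, g (Wy k i) = y i
      & forall j, g (Wpsi j) = psi j].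
Proof.
move=> R; pose h (t : Wgen n) : B :=
  match t with inl (inl i) => e i | inl (inr i) => y i | inr j => psi j end.
have [f fM fh] := free_lift h.
have f0 x : Wrel x -> f x = 0.
  move: x; apply/(W_relationsP fM).
  have -> : (fun i => f (ge i)) = e by apply: boolp.funext => i; rewrite fh.
  have -> : (fun i => f (gy i)) = y by apply: boolp.funext => i; rewrite fh.
  by have -> : (fun j => f (gpsi j)) = psi by apply: boolp.funext => i; rewrite fh.
have [g gM gE] := quot_lift fM f0.
by exists g => //; split=> i; rewrite gE fh.
Qed.

Lemma W_eq (B : kalgType k) (f g : W k n -> B) :
    kalg_morphism f -> kalg_morphism g ->
    (forall i, f (We k i) = g (We k i)) -> (forall i, f (Wy k i) = g (Wy k i)) ->
    (forall j, f (Wpsi j) = g (Wpsi j)) ->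
  f =1 g.
Proof.
move=> fM gM fge fgy fgpsi x; have [w ->] := quot_pi_surj x.
have piM := quot_pi_kalgm (@Wrel k n).
move: w; apply: (free_eq (kalgm_comp piM fM) (kalgm_comp piM gM)).
by case=> [[i|i]|j] /=; [apply: fge | apply: fgy | apply: fgpsi].
Qed.

End WebsterPresentation.

(** * Consequences of the relations *)

Section WebsterRelations.
Variables (k : fieldType) (n : nat) (B : kalgType k).
Variables (e y : 'I_n.+1 -> B) (psi : 'I_n -> B).
Hypothesis R : W_relations e y psi.
Local Notation idx := (@idx n).
Local Notation idxS := (@idxS n).

(** The element [Wx l] for a general choice of generators. *)
Definition x_elt (l : 'I_n) : B :=
  \sum_(i < n.+1 | (l < i)%N) y (idx l) * e i
  + \sum_(i < n.+1 | (i <= l)%N) y (idxS l) * e i.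

Lemma W_ee0 i j : i != j -> e i * e j = 0.
Proof. by rewrite (W_ee R) => /negPf ->; rewrite mul0r. Qed.

Lemma W_eid i : e i * e i = e i.
Proof. by rewrite (W_ee R) eqxx mul1r. Qed.

Lemma W_ecomm i j : e i * e j = e j * e i.
Proof. by have [->|ij] := eqVneq i j; rewrite // !W_ee0 // eq_sym. Qed.

Lemma x_elt_comm l m : GRing.comm (x_elt l) (x_elt m).
Proof.
have yeC i j a b : GRing.comm (y i * e j) (y a * e b).
  apply: commrM; apply: commr_sym; apply: commrM; rewrite /GRing.comm.
  - exact: (W_yy R).
  - exact: (W_ye R).
  - by rewrite (W_ye R).
  exact: W_ecomm.
apply: commrD; apply: commr_sum => b _; apply: commr_sym;
  by apply: commrD; apply: commr_sum => j _; apply: commr_sym; apply: yeC.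
Qed.

Lemma x_elt_e l i : x_elt l * e i = y (if (l < i)%N then idx l else idxS l) * e i.
Proof.
have sumE (P : pred 'I_n.+1) z :
    (\sum_(j < n.+1 | P j) z * e j) * e i = if P i then z * e i else 0.
  rewrite mulr_suml; case: ifP => Pi; last first.
    rewrite big1 // => j Pj; rewrite -mulrA W_ee0 ?mulr0 //.
    by apply/eqP => ji; rewrite -ji Pj in Pi.
  rewrite (bigD1 i) //= -mulrA W_eid big1 ?addr0 // => j /andP[_ ji].
  by rewrite -mulrA W_ee0 ?mulr0.
by rewrite /x_elt mulrDl !sumE ltnNge; case: leqP; rewrite ?addr0 ?add0r.
Qed.

(** [psi_j] is the sum of its two arrows: multiply by [1 = \sum_i e_i] and drop
    the terms with [i] different from [j] and [j+1]. *)
Lemma W_psi_split j :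
  psi j = e (idxS j) * psi j * e (idx j) + e (idx j) * psi j * e (idxS j).
Proof.
rewrite -(W_psie R) -(W_psieS R) -!mulrA !W_eid.
rewrite -[LHS]mulr1 -(W_sum_e R) mulr_sumr (bigD1 (idx j)) //=; congr (_ + _).
rewrite (bigD1 (idxS j)) //= ?big1 ?addr0 // => [i /andP[ij ijS]|].
  exact: (W_psie0 R).
by rewrite -val_eqE /= /bump /= eqn_leq ltnn.
Qed.

(** When all [x_l] vanish, what remains of the [y_l] is one loop at each vertex,
    and each loop is the product of two opposite arrows. *)
Section VanishingX.
Hypothesis x0 : forall l, x_elt l = 0.

(** For [a != i], [y_a e_i] is [x_a e_i] or [x_{a-1} e_i], according to the
    side of [i] on which [a] lies. *)
Lemma W_y_e0 a i : a != i -> y a * e i = 0.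
Proof.
move=> ai; case: (ltngtP a i) => [lt_ai|lt_ia|/val_inj/eqP]; last by rewrite (negPf ai).
  have an : (a < n)%N by rewrite (leq_trans lt_ai) // -ltnS.
  have := x_elt_e (Ordinal an) i; rewrite x0 mul0r lt_ai => ->.
  by congr (y _ * _); apply: val_inj.
case: (unliftP ord0 a) => [b ab|a0]; last by rewrite a0 in lt_ia.
have := x_elt_e b i; rewrite x0 mul0r ltnNge (_ : (i <= b)%N) /= => [->|].
  by rewrite ab.
by rewrite -ltnS; move: lt_ia; rewrite ab.
Qed.

Lemma W_y_eq_ye a : y a = y a * e a.
Proof.
rewrite -[LHS]mulr1 -(W_sum_e R) mulr_sumr (bigD1 a) //= big1 ?addr0 // => i ia.
by rewrite W_y_e0 // eq_sym.
Qed.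

Lemma W_up j : e (idxS j) * psi j * e (idx j) = psi j * e (idx j).
Proof. by rewrite -(W_psie R) -mulrA W_eid. Qed.

Lemma W_down j : e (idx j) * psi j * e (idxS j) = psi j * e (idxS j).
Proof. by rewrite -(W_psieS R) -mulrA W_eid. Qed.

(** Both sides are [psi_j^2 e_j] by [W_psi2], as [y_{j+1} e_j = 0]. *)
Lemma W_down_up j :
  e (idx j) * psi j * e (idxS j) * (e (idxS j) * psi j * e (idx j)) = y (idx j).
Proof.
rewrite W_up W_down -mulrA (mulrA (e _)) -(W_psie R) -(mulrA (psi j)) W_eid.
rewrite mulrA -expr2 (W_psi2 R) mulrBl -W_y_eq_ye W_y_e0 ?subr0 //.
by rewrite -val_eqE /= /bump /= eqn_leq ltnn.
Qed.

Lemma W_up_down j :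
  e (idxS j) * psi j * e (idx j) * (e (idx j) * psi j * e (idxS j)) = y (idxS j).
Proof.
rewrite W_up W_down -mulrA (mulrA (e _)) -(W_psieS R) -(mulrA (psi j)) W_eid.
rewrite mulrA -expr2 (W_psi2S R) mulrBl -W_y_eq_ye W_y_e0 ?subr0 //.
by rewrite -val_eqE /= /bump /= eqn_leq ltnn andbF.
Qed.

End VanishingX.
End WebsterRelations.

(** * Representations of the quiver give representations of W(n,1) *)

(** The converse of the previous section.  Given idempotents, arrows [up], [dn]
    and loops [y] equal to every length-two path at their vertex, setting
    [psi j := up j + dn j] gives the relations of W(n,1) with all [x_l = 0].
    Every relation compares products of paths, most of which vanish because
    their ends do not match. *)
Section ArrowsToWebster.
Variables (k : fieldType) (n : nat) (B : kalgType k).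
Variables (e y : 'I_n.+1 -> B) (up dn : 'I_n -> B).
Local Notation idx := (@idx n).
Local Notation idxS := (@idxS n).
Hypothesis ee : forall i j, e i * e j = if i == j then e i else 0.
Hypothesis sum_e : \sum_i e i = 1.
Hypothesis e0 : e ord0 = 0.
Hypothesis upE : forall j, e (idxS j) * up j * e (idx j) = up j.
Hypothesis dnE : forall j, e (idx j) * dn j * e (idxS j) = dn j.
Hypothesis yE : forall i, e i * y i * e i = y i.
Hypothesis y_idx : forall j, y (idx j) = dn j * up j.
Hypothesis y_idxS : forall j, y (idxS j) = up j * dn j.

Let psi j := up j + dn j.

(** [x] goes from the vertex [i] to the vertex [j]. *)
Let hom j i x := e j * x * e i = x.

Lemma hom_mul_e j i x a : hom j i x -> x * e a = if i == a then x else 0.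
Proof.
by move=> xE; rewrite -xE -!mulrA ee; case: eqP => [->|_]; rewrite ?mulr0.
Qed.

Lemma hom_e_mul j i x a : hom j i x -> e a * x = if a == j then x else 0.
Proof.
by move=> xE; rewrite -xE !mulrA ee; case: eqP => [->|_]; rewrite ?mul0r.
Qed.

Lemma hom_mul0 j i x j' i' x' : hom j i x -> hom j' i' x' -> i != j' -> x * x' = 0.
Proof.
by move=> xE x'E /negPf ij'; rewrite -xE -(mulrA _ (e i)) (hom_e_mul _ x'E) ij' mulr0.
Qed.

Lemma arrows_W_relations : W_relations e y psi.
Proof.
have hu j : hom (idxS j) (idx j) (up j) := upE j.
have hd j : hom (idx j) (idxS j) (dn j) := dnE j.
have hy i : hom i i (y i) := yE i.
have idx_eq j l : (idx j == idxS l) = (j == l.+1 :> nat) by [].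
have idxSN j : idx j != idxS j by rewrite idx_eq eqn_leq ltnn andbF.
have idxSN' j : idxS j != idx j by rewrite eq_sym.
split.
- by move=> i j; rewrite ee; case: eqP; rewrite (mul1r, mul0r).
- exact: sum_e.
- move=> i j; rewrite (hom_mul_e _ (hy j)) (hom_e_mul _ (hy j)) eq_sym.
  by case: eqP.
- move=> i j; have [->//|ij] := eqVneq i j.
  by rewrite (hom_mul0 (hy _) (hy _)) // (hom_mul0 (hy _) (hy _)) // eq_sym.
- move=> i j /negPf ij /negPf ijS.
  rewrite mulrDl (hom_mul_e _ (hu j)) (hom_mul_e _ (hd j)) ![_ == i]eq_sym.
  by rewrite ij ijS addr0.
- move=> j; rewrite mulrDl mulrDr (hom_mul_e _ (hu j)) (hom_mul_e _ (hd j)).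
  rewrite (hom_e_mul _ (hu j)) (hom_e_mul _ (hd j)) !eqxx.
  by rewrite (negPf (idxSN' j)).
- move=> j; rewrite mulrDl mulrDr (hom_mul_e _ (hu j)) (hom_mul_e _ (hd j)).
  rewrite (hom_e_mul _ (hu j)) (hom_e_mul _ (hd j)) !eqxx.
  by rewrite (negPf (idxSN j)).
- suff psi0 (j l : 'I_n) : (j.+1 < l)%N || (l.+1 < j)%N -> psi j * psi l = 0.
    by move=> j l jl; rewrite !psi0 // orbC.
  move=> jl; rewrite mulrDl !mulrDr.
  rewrite (hom_mul0 (hu j) (hu l)) 1?(hom_mul0 (hu j) (hd l)).
  + rewrite (hom_mul0 (hd j) (hu l)) 1?(hom_mul0 (hd j) (hd l)) ?addr0 //;
    rewrite -val_eqE /= /bump /=; lia.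
  + rewrite -val_eqE /=; lia.
  + rewrite -val_eqE /= /bump /=; lia.
- move=> j l lj ljS; rewrite mulrDl mulrDr.
  by rewrite (hom_mul0 (hu j) (hy l)) 1?(hom_mul0 (hd j) (hy l))
    1?(hom_mul0 (hy l) (hu j)) 1?(hom_mul0 (hy l) (hd j)) // eq_sym.
- move=> j; rewrite mulrDl mulrDr (hom_mul0 (hd j) (hy _)) //.
  by rewrite (hom_mul0 (hy _) (hd j)) // y_idx y_idxS mulrA.
- move=> j; rewrite mulrDl mulrDr (hom_mul0 (hu j) (hy _)) //.
  by rewrite (hom_mul0 (hy _) (hu j)) // y_idx y_idxS mulrA.
- move=> j; rewrite mulrBl (hom_mul_e _ (hy _)) (hom_mul_e _ (hy (idxS j))).
  rewrite eqxx (negPf (idxSN' j)) subr0 expr2 -mulrA [_ * e _]mulrDl.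
  rewrite (hom_mul_e _ (hu j)) (hom_mul_e _ (hd j)) eqxx (negPf (idxSN' j)) addr0.
  by rewrite mulrDl (hom_mul0 (hu j) (hu j)) // add0r y_idx.
- move=> j; rewrite mulrBl (hom_mul_e _ (hy _)) (hom_mul_e _ (hy (idx j))).
  rewrite eqxx (negPf (idxSN j)) subr0 expr2 -mulrA [_ * e _]mulrDl.
  rewrite (hom_mul_e _ (hu j)) (hom_mul_e _ (hd j)) eqxx (negPf (idxSN j)) add0r.
  by rewrite mulrDl (hom_mul0 (hd j) (hd j)) // addr0 y_idxS.
(* Braid relation: the only nonzero products of two neighbouring psi are the
   straight paths of length two, and a third factor kills them on both sides. *)
- move=> j l jl.
  have jlE : idxS j = idx l by apply: val_inj; rewrite /= /bump /= jl.
  have ul0 : up j * up l = 0.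
    by rewrite (hom_mul0 (hu j) (hu l)) // -val_eqE /= /bump /= jl; lia.
  have dl0 : dn l * dn j = 0.
    by rewrite (hom_mul0 (hd l) (hd j)) // -val_eqE /= /bump /= jl; lia.
  have ud0 : up j * dn l = 0.
    by rewrite (hom_mul0 (hu j) (hd l)) // -val_eqE /= jl; lia.
  have du0 : up l * dn j = 0.
    by rewrite (hom_mul0 (hu l) (hd j)) // -val_eqE /= jl; lia.
  have du0' : dn j * up l = 0.
    by rewrite (hom_mul0 (hd j) (hu l)) // -val_eqE /= /bump /= jl; lia.
  have ud0' : dn l * up j = 0.
    by rewrite (hom_mul0 (hd l) (hu j)) // -val_eqE /= /bump /= jl; lia.
  have -> : psi j * psi l = dn j * dn l.
    by rewrite mulrDl !mulrDr ul0 ud0 du0' !add0r.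
  have -> : psi l * psi j = up l * up j.
    by rewrite mulrDl !mulrDr dl0 du0 ud0' !addr0.
  by rewrite !mulrDr -!mulrA ud0' dl0 ul0 ud0 !mulr0.
exact: e0.
Qed.

Lemma arrows_up j : e (idxS j) * psi j * e (idx j) = up j.
Proof.
rewrite mulrDr mulrDl upE (hom_e_mul _ (dnE j)) -val_eqE /= /bump /=.
by rewrite eqn_leq ltnn mul0r addr0.
Qed.

Lemma arrows_dn j : e (idx j) * psi j * e (idxS j) = dn j.
Proof.
rewrite mulrDr mulrDl dnE (hom_e_mul _ (upE j)) -val_eqE /= /bump /=.
by rewrite eqn_leq ltnn andbF mul0r add0r.
Qed.

Lemma arrows_y_e i a : y a * e i = if a == i then y a else 0.
Proof. exact: hom_mul_e (yE a). Qed.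

Lemma arrows_x0 l : x_elt e y l = 0.
Proof.
rewrite /x_elt !big1 ?addr0 // => i li; rewrite arrows_y_e; case: eqP => // ii;
  by move: li; rewrite -ii /= /bump /= ?ltnn.
Qed.

End ArrowsToWebster.

(** * Generators of A_n^! and the morphism from W(n,1) *)

Lemma mul0_sandwich (R : pzRingType) (a b x : R) : x = 0 -> a * x * b = x.
Proof. by move=> ->; rewrite mulr0 mul0r. Qed.

Section AnElements.
Variables (k : fieldType) (n : nat).
Local Notation idx := (@idx n).
Local Notation idxS := (@idxS n).
Local Notation PA := (pathAlg (@An_arrow n) k).
Local Notation pv v s := (pathv (@An_arrow n) k v s : PA).
Local Notation is_path := (path (fun v u => An_arrow u v)).
Local Notation A := (An_dual k n).

Definition An_pi : PA -> A := quot_pi (@An_rel k n).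
Definition An_path (v : 'I_n) (s : seq 'I_n) : A := An_pi (pv v s).

Lemma An_pathM (u : 'I_n) s (v : 'I_n) t : is_path u s -> is_path v t ->
  An_path u s * An_path v t = if last u s == v then An_path u (s ++ t) else 0.
Proof.
by move=> us vt; rewrite -(kalgmM (quot_pi_kalgm _)) pathvM //; case: ifP.
Qed.

Lemma An_path_out (v : 'I_n) s : ~~ is_path v s -> An_path v s = 0.
Proof.
by move=> nvs; rewrite /An_path /pathv insubN.
Qed.

Lemma ord_pred_subproof (j : 'I_n) : (j.-1 < n)%N.
Proof. exact: leq_ltn_trans (leq_pred j) (ltn_ord j). Qed.
(** The preceding vertex, and the first vertex for itself: as no arrow joins a
    vertex to itself, [An_up] and [An_dn] vanish there, as they should for
    arrows through [e_1 = 0]. *)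
Definition ordp (j : 'I_n) : 'I_n := Ordinal (ord_pred_subproof j).

(** The vertex [v] of A_n^! corresponds to the idempotent of index [v + 1] of
    W(n,1), the index [0] being that of the vanishing one. *)
Definition An_e (i : 'I_n.+1) : A :=
  if unlift ord0 i is Some v then An_path v [::] else 0.
Definition An_up (j : 'I_n) : A := An_path j [:: ordp j].
Definition An_dn (j : 'I_n) : A := An_path (ordp j) [:: j].
Definition An_y (i : 'I_n.+1) : A :=
  if unlift ord0 i is Some v then An_up v * An_dn v else 0.

Lemma An_eS j : An_e (idxS j) = An_path j [::].
Proof. by rewrite /An_e liftK. Qed.

Lemma An_e0 : An_e ord0 = 0.
Proof. by rewrite /An_e unlift_none. Qed.

Lemma An_yS j : An_y (idxS j) = An_up j * An_dn j.
Proof. by rewrite /An_y liftK. Qed.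

Lemma idx_ord_pred (j : 'I_n) : (0 < j)%N -> idx j = idxS (ordp j).
Proof. by move=> j0; apply: val_inj; rewrite /= /bump /= add1n prednK. Qed.

Lemma idx0 (j : 'I_n) : j = 0%N :> nat -> idx j = ord0.
Proof. by move=> j0; apply: val_inj; rewrite /= j0. Qed.

Lemma arrow_ord_pred (j : 'I_n) : (0 < j)%N ->
  An_arrow (ordp j) j /\ An_arrow j (ordp j).
Proof. by move=> j0; rewrite /An_arrow /= prednK // eqxx orbT. Qed.

Lemma An_up0 (j : 'I_n) : j = 0%N :> nat -> An_up j = 0.
Proof. by move=> j0; apply: An_path_out; rewrite /= /An_arrow /= j0. Qed.

Lemma An_dn0 (j : 'I_n) : j = 0%N :> nat -> An_dn j = 0.
Proof. by move=> j0; apply: An_path_out; rewrite /= /An_arrow /= j0. Qed.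

Lemma An_ee i j : An_e i * An_e j = if i == j then An_e i else 0.
Proof.
rewrite /An_e; case: (unliftP ord0 i) => [v ->|->]; last by rewrite mul0r if_same.
case: (unliftP ord0 j) => [u ->|->]; last by rewrite mulr0.
by rewrite An_pathM //= (inj_eq lift_inj).
Qed.

Lemma An_sum_e : \sum_i An_e i = 1.
Proof.
rewrite big_ord_recl An_e0 add0r -(kalgm1 (quot_pi_kalgm (@An_rel k n))).
rewrite [in RHS]/GRing.one /= /path_one (kalgm_sum (quot_pi_kalgm _)).
by apply: eq_bigr => v _; rewrite An_eS.
Qed.

Lemma An_upE j : An_e (idxS j) * An_up j * An_e (idx j) = An_up j.
Proof.
have [j0|j0] := posnP j; first exact/mul0_sandwich/An_up0.
have [a1 a2] := arrow_ord_pred j0.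
by rewrite (idx_ord_pred j0) !An_eS /An_up !An_pathM //= ?a1 ?a2 // !eqxx
  An_pathM //= ?a1 ?a2 // eqxx.
Qed.

Lemma An_dnE j : An_e (idx j) * An_dn j * An_e (idxS j) = An_dn j.
Proof.
have [j0|j0] := posnP j; first exact/mul0_sandwich/An_dn0.
have [a1 a2] := arrow_ord_pred j0.
by rewrite (idx_ord_pred j0) !An_eS /An_dn !An_pathM //= ?a1 ?a2 // !eqxx
  An_pathM //= ?a1 ?a2 // eqxx.
Qed.

(** This is where the relations of A_n^! enter: the loop at a vertex through the
    preceding one equals the loop through the following one. *)
Lemma An_y_idx j : An_y (idx j) = An_dn j * An_up j.
Proof.
have [j0|j0] := posnP j.
  by rewrite An_dn0 // mul0r idx0 // /An_y unlift_none.
have [a1 a2] := arrow_ord_pred j0.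
rewrite (idx_ord_pred j0) An_yS [RHS]An_pathM /= ?a1 ?a2 // eqxx; set i := ordp j.
have ji : j = i.+1 :> nat by rewrite /= prednK.
have [i0|i0] := posnP i.
  rewrite An_up0 // mul0r; apply/esym/eqP.
  rewrite -(kalgm0 (quot_pi_kalgm (@An_rel k n))); apply/eqP/esym/quot_piP.
  by apply: ideal_gen_in; apply: An_rel_first.
have [b1 b2] := arrow_ord_pred i0.
rewrite [LHS]An_pathM /= ?b1 ?b2 // eqxx; apply/quot_piP.
by apply: ideal_gen_in; apply: An_rel_next => //=; rewrite prednK.
Qed.

Lemma An_yE i : An_e i * An_y i * An_e i = An_y i.
Proof.
case: (unliftP ord0 i) => [j ->|->]; last first.
  by apply: mul0_sandwich; rewrite /An_y unlift_none.
have [j0|j0] := posnP j.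
  by apply: mul0_sandwich; rewrite An_yS An_up0 // mul0r.
have [a1 a2] := arrow_ord_pred j0.
by rewrite An_yS An_eS /An_up /An_dn !An_pathM //= ?a1 ?a2 // eqxx
  An_pathM //= ?a1 ?a2 // eqxx An_pathM /= ?a1 ?a2 // eqxx.
Qed.

Lemma An_W_relations : W_relations An_e An_y (fun j => An_up j + An_dn j).
Proof.
exact: (arrows_W_relations An_ee An_sum_e An_e0 An_upE An_dnE An_yE An_y_idx An_yS).
Qed.

Lemma An_up_split j :
  An_e (idxS j) * (An_up j + An_dn j) * An_e (idx j) = An_up j.
Proof. exact: (arrows_up An_ee An_upE An_dnE). Qed.

Lemma An_dn_split j :
  An_e (idx j) * (An_up j + An_dn j) * An_e (idxS j) = An_dn j.
Proof. exact: (arrows_dn An_ee An_upE An_dnE). Qed.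

Lemma An_x0 l : x_elt An_e An_y l = 0.
Proof. exact: (arrows_x0 An_ee An_yE). Qed.

End AnElements.

(** * Maps out of A_n^! *)

Section AnLift.
Variables (k : fieldType) (n : nat).
Local Notation idx := (@idx n).
Local Notation idxS := (@idxS n).

Lemma An_eq (B : kalgType k) (f g : An_dual k n -> B) :
    kalg_morphism f -> kalg_morphism g ->
    (forall i, f (An_e k i) = g (An_e k i)) ->
    (forall j, f (An_up k j) = g (An_up k j)) ->
    (forall j, f (An_dn k j) = g (An_dn k j)) ->
  f =1 g.
Proof.
move=> fM gM fge fgu fgd x; have [w ->] := quot_pi_surj x.
have piM := quot_pi_kalgm (@An_rel k n).
move: w; apply: (path_eq (kalgm_comp piM fM) (kalgm_comp piM gM)) => [v|v u].
  by have := fge (idxS v); rewrite An_eS.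
move=> /orP[/eqP vu|/eqP uv].
  by have := fgu v; rewrite /An_up (_ : ordp v = u) //; apply: val_inj; rewrite /= vu.
by have := fgd u; rewrite /An_dn (_ : ordp u = v) //; apply: val_inj; rewrite /= uv.
Qed.

Variables (B : kalgType k) (e y : 'I_n.+1 -> B) (psi : 'I_n -> B).
Hypothesis R : W_relations e y psi.
Hypothesis x0 : forall l, x_elt e y l = 0.

(** The relation at the vertex [i] holds because both loops there equal
    [y_{i+1}], by [W_down_up] and [W_up_down]; at the first vertex the loop
    through [e_1 = 0] vanishes. *)
Lemma An_lift : exists2 g : An_dual k n -> B, kalg_morphism g &
  [/\ forall i, g (An_e k i) = e i,
      forall j, g (An_up k j) = e (idxS j) * psi j * e (idx j)
    & forall j, g (An_dn k j) = e (idx j) * psi j * e (idxS j)].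
Proof.
pose E (v : 'I_n) := e (idxS v).
pose a (v u : 'I_n) := E v * psi (if (u < v)%N then v else u) * E u.
have EE u v : E u * E v = if u == v then E u else 0.
  rewrite /E (W_ee R) (inj_eq lift_inj).
  by case: eqP => [->|_]; rewrite ?mul1r ?mul0r.
have sumE : \sum_v E v = 1.
  by rewrite -(W_sum_e R) big_ord_recl (W_e1 R) add0r.
have aE v u : E v * a v u * E u = a v u.
  by rewrite /a !mulrA EE eqxx -[_ * E u * E u]mulrA EE eqxx.
have idxE (i j : 'I_n) : j = i.+1 :> nat -> idxS i = idx j.
  by move=> ji; apply: val_inj; rewrite /= /bump /= ji.
have a_up (i j : 'I_n) : j = i.+1 :> nat -> a j i = e (idxS j) * psi j * e (idx j).
  by move=> ji; rewrite /a /E ji ltnSn (idxE i j).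
have a_dn (i j : 'I_n) : j = i.+1 :> nat -> a i j = e (idx j) * psi j * e (idxS j).
  by move=> ji; rewrite /a /E ji ltnNge leqnSn (idxE i j).
have [h hM hE] := path_lift (@An_arrow n) EE sumE aE.
have aEr v u : a v u * E u = a v u by rewrite /a -mulrA EE eqxx.
have arr (i j : 'I_n) : j = i.+1 :> nat -> An_arrow i j /\ An_arrow j i.
  by move=> ji; rewrite /An_arrow ji eqxx orbT.
have h_next (i j : 'I_n) : j = i.+1 :> nat ->
    h (pathv (@An_arrow n) k i [:: j; i]) = y (idx j).
  move=> ji; have [a1 a2] := arr i j ji; rewrite hE /= ?a1 ?a2 //.
  by rewrite aEr (a_up i j) // (a_dn i j) // (W_down_up R x0).
have h_prev (i j : 'I_n) : j = i.+1 :> nat ->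
    h (pathv (@An_arrow n) k j [:: i; j]) = y (idxS j).
  move=> ji; have [a1 a2] := arr i j ji; rewrite hE /= ?a1 ?a2 //.
  by rewrite aEr (a_up i j) // (a_dn i j) // (W_up_down R x0).
have h0 x : An_rel x -> h x = 0.
  case=> [i j i0 ji|l i j il ji]; rewrite kalgmB //.
    rewrite h_next // -(idxE i j) // -(W_up_down R x0 i) idx0 // (W_e1 R).
    by rewrite mulr0 mul0r kalgm0 // subrr.
  by rewrite (h_next i j) // (h_prev l i) // (idxE i j) // subrr.
have [g gM gE] := quot_lift hM h0.
have ge i : g (An_e k i) = e i.
  rewrite /An_e; case: (unliftP ord0 i) => [v ->|->].
    by rewrite gE hE.
  by rewrite kalgm0 // (W_e1 R).
exists g => //; split=> // j; have [j0|j0] := posnP j.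
- by rewrite An_up0 // kalgm0 // idx0 // (W_e1 R) mulr0.
- have [a1 a2] := arrow_ord_pred j0.
  by rewrite gE hE /= ?a1 ?a2 // aEr; apply: a_up; rewrite /= prednK.
- by rewrite An_dn0 // kalgm0 // idx0 // (W_e1 R) !mul0r.
have [a1 a2] := arrow_ord_pred j0.
by rewrite gE hE /= ?a1 ?a2 // aEr; apply: a_dn; rewrite /= prednK.
Qed.

End AnLift.

(** * The retraction onto the polynomial ring *)

Section Retraction.
Variables (k : fieldType) (n : nat).
Local Notation P := {mpoly k[n.+1]}.

Definition ret_e (i : 'I_n.+2) : P := (i == ord_max)%:R.

(** The last two [y] go to the same variable: as [psi_n] goes to [0] and
    [e_{n+1}] to [1], the relation [W_psi2S] requires it. *)
Definition ret_y (i : 'I_n.+2) : P := 'X_(inord (minn i n)).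

Lemma ret_W_relations : W_relations ret_e ret_y (fun _ : 'I_n.+1 => 0 : P).
Proof.
split; try by move=> *; rewrite ?(mul0r, mulr0) // mulrC.
- move=> i j; rewrite /ret_e -!natrM !mulnb.
  have [->|ij] := eqVneq i j; rewrite ?andbb //=; case: eqP => //= im.
  by rewrite -im eq_sym (negPf ij).
- rewrite (bigD1 ord_max) //= /ret_e eqxx big1 ?addr0 // => i /negPf ->.
  by [].
- move=> j; rewrite expr2 !mul0r /ret_e -val_eqE /=.
  by rewrite (ltn_eqF (ltn_ord j)) mulr0.
- move=> j; rewrite expr2 !mul0r /ret_e -val_eqE /= /bump /= add1n eqSS.
  case: eqP => [jn|_]; last by rewrite mulr0.
  rewrite mulr1 /ret_y /= /bump /= jn minnn (minn_idPr _) ?subrr //.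
Qed.

Lemma ret_x l : x_elt ret_e ret_y l = 'X_l.
Proof.
have e1 : ret_e ord_max = 1 by rewrite /ret_e eqxx.
rewrite -[LHS]mulr1 -e1 (x_elt_e ret_W_relations) /= ltn_ord e1 mulr1 /ret_y /=.
by congr 'X_ _; apply: val_inj; rewrite /= inordK ?(minn_idPl _) // -ltnS.
Qed.

End Retraction.

(** * The deformation theorem *)

Section Evaluation.
Variables (k : fieldType) (n : nat).

Lemma x_elt_morph (A B : kalgType k) (f : A -> B) (e y : 'I_n.+1 -> A) e' y' l :
    kalg_morphism f -> (forall i, f (e i) = e' i) -> (forall i, f (y i) = y' i) ->
  f (x_elt e y l) = x_elt e' y' l.
Proof.
move=> fM fe fy; rewrite /x_elt (kalgmD fM) !(kalgm_sum fM).
by congr (_ + _); apply: eq_bigr => i _; rewrite (kalgmM fM) fe fy.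
Qed.

Lemma kalgm_id (A : kalgType k) : kalg_morphism (@id A).
Proof. by split. Qed.

Lemma mcoeff0_kalgm (A : kalgType k) :
  kalg_morphism (fun p : {mpoly k[n]} => kalgC p@_0%MM : A).
Proof.
split=> [p q|p q|c]; first by rewrite mcoeffD kalgCD.
  by rewrite rmorphM kalgCM.
by rewrite mpoly_kalgCE mcoeffC eqxx mulr1.
Qed.

End Evaluation.

Theorem mainTheorem2 (k : fieldType) (n : nat)
    (k_infinite : cardinality.infinite_set (@classical_sets.setT k))
    (k_char : 2%N \notin [pchar k]) (n_gt0 : (0 < n)%N) :
  exists phi : {mpoly k[n]} -> W k n,
    [/\ kalg_morphism phi,
        injective phi,
        forall l : 'I_n, phi 'X_l = Wx k l
      & kalg_isomorphic
          (quotAlg (fun w : W k n =>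
             exists p : {mpoly k[n]}, p@_0%MM = 0 /\ phi p = w))
          (An_dual k n)].
Proof.
have idM := @kalgm_id k.
have RW := W_relations_morph (idM (W k n)).
have [phi phiM phiX] := mpoly_lift (x_elt_comm RW).
have {}phiX l : phi 'X_l = x_elt (@We k n) (@Wy k n) l by apply: phiX.
exists phi; split=> //.
  (* The retraction needs a last polynomial variable, so [n] is a successor. *)
  case: n n_gt0 phi phiM phiX {RW} => // m _ phi phiM phiX.
  have [rho rhoM [rhoe rhoy _]] := W_lift (@ret_W_relations k m).
  suff rhoK : cancel phi rho by apply: can_inj rhoK.
  apply: (mpoly_eq (kalgm_comp phiM rhoM) (idM _)) => l /=.
  by rewrite phiX (x_elt_morph l rhoM rhoe rhoy) ret_x.
(* The morphism [F] from the quotient to A_n^!. *)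
set S := (fun w => _); set Q := quotAlg S.
have piM := quot_pi_kalgm S.
have [f fM [fe fy fpsi]] := W_lift (@An_W_relations k n).
have fX l : f (phi 'X_l) = 0.
  by rewrite phiX (x_elt_morph l fM fe fy); apply: An_x0.
(* [f \o phi] is the evaluation at 0, hence kills the ideal. *)
have fphi p : f (phi p) = kalgC p@_0%MM.
  move: p; apply: (mpoly_eq (kalgm_comp phiM fM) (@mcoeff0_kalgm k n _)) => l /=.
  by rewrite fX mcoeffX mnm1_eq0 kalgC0.
have fS w : S w -> f w = 0 by case=> p [p0 <-]; rewrite fphi p0 kalgC0.
have [F FM FE] := quot_lift fM fS.
(* Its inverse [G]. *)
have RQ := W_relations_morph piM.
have xQ0 l : x_elt (fun i => quot_pi S (We k i)) (fun i => quot_pi S (Wy k i)) l = 0.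
  rewrite -(x_elt_morph l piM (fun _ => erefl) (fun _ => erefl)).
  rewrite -(kalgm0 piM); apply/quot_piP; rewrite subr0.
  apply: ideal_gen_in; exists 'X_l.
  by rewrite phiX; split=> //; rewrite mcoeffX mnm1_eq0.
have [G GM [Ge Gu Gd]] := An_lift RQ xQ0.
exists F; split=> //; exists G.
  move=> x; have [w ->] := quot_pi_surj x; move: w.
  apply: (W_eq (kalgm_comp piM (kalgm_comp FM GM)) piM) => [i|i|j] /=.
  - by rewrite FE fe Ge.
  - rewrite FE fy /An_y; case: (unliftP ord0 i) => [j ->|->].
      by rewrite kalgmM // Gu Gd (W_up_down RQ xQ0).
    by rewrite kalgm0 // [RHS](W_y_eq_ye RQ xQ0) (W_e1 RQ) mulr0.
  by rewrite FE fpsi kalgmD // Gu Gd -(W_psi_split RQ).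
apply: (An_eq (kalgm_comp GM FM) (idM _)) => [i|j|j] /=.
- by rewrite Ge FE fe.
- rewrite Gu 2!(kalgmM FM) !FE !fe fpsi; exact: An_up_split.
rewrite Gd 2!(kalgmM FM) !FE !fe fpsi; exact: An_dn_split.
Qed.
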